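(* Let $E$ be a non-zero Banach space. Then $\mathrm{Mltp}_{\mathrm{u}}(E)$ is open in $\mathrm{Mltp}(E)$, and $\mathrm{Mltp}_{\mathrm{c}}(E)$ is closed in $\mathrm{Mltp}(E)$.
   Context: $\mathrm{B}_2(E)$ is the Banach space of bounded bilinear maps $E\times E\to E$ with the operator norm $|\varphi|=\sup\{\|\varphi(x,y)\|:\|x\|\leq1,\|y\|\leq1\}$. $\mathrm{Mltp}(E)\subset\mathrm{B}_2(E)$ is the set of continuous multiplications on $E$, i.e. of those $*\in\mathrm{B}_2(E)$ that are associative as binary operations on $E$, with the subspace topology from $\mathrm{B}_2(E)$. $\mathrm{Mltp}_{\mathrm{u}}(E)$ (resp. $\mathrm{Mltp}_{\mathrm{c}}(E)$) is the set of $*\in\mathrm{Mltp}(E)$ such that the algebra $(E,* )$ is unital, i.e. has a two-sided unit (resp. is commutative). *)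

(* Defs.v *)
From HB Require Import structures.
From mathcomp Require Import all_boot all_order all_algebra.
From mathcomp Require Import sesquilinear.
From mathcomp Require Import all_classical all_reals.
From mathcomp Require Import topology normedtype.
From mathcomp Require Import complex.

Set Implicit Arguments.
Unset Strict Implicit.
Unset Printing Implicit Defensive.

Import Order.TTheory GRing.Theory Num.Theory.
Import numFieldNormedType.Exports.

Local Open Scope classical_set_scope.
Local Open Scope ring_scope.

(* Banach spaces are over the real or the complex numbers; a scalar field is
   one of these two, so that a statement quantified over [k : scalar_kind]
   covers both cases. *)
Variant scalar_kind := RealScalars | ComplexScalars.

Definition scalars (R : realType) (k : scalar_kind) : numFieldType :=
  match k with
  | RealScalars => R
  | ComplexScalars => R[i]
  end.

(* [R[i]] is only partially ordered, but its nonnegative elements are the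
   nonnegative reals, so the suprema that define operator norms exist in
   both fields. *)
Lemma scalars_supremums (R : realType) (k : scalar_kind)
    (A : set (scalars R k)) :
  (forall a, A a -> 0 <= a) -> A !=set0 -> has_ubound A ->
  supremums A !=set0.
Proof.
case: k A => /= A A0 [a0 Aa0] [M AM].
  exists (sup A); split => [|y yA]; first by apply: ub_le_sup; exists M.
  by apply: ge_sup => //; exists a0.
pose B : set R := [set r | A r%:C%C].
have AB (a : R[i]) : A a -> a = (complex.Re a)%:C%C.
  by move=> Aa; rewrite RRe_real// ger0_real// A0.
have uB (y : R[i]) : ubound A y -> y = (complex.Re y)%:C%C.
  move=> yA; rewrite RRe_real// ger0_real//.
  exact: le_trans (A0 _ Aa0) (yA _ Aa0).
have B0 : B !=set0 by exists (complex.Re a0); rewrite /B /= -AB.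
have BM : has_ubound B.
  by exists (complex.Re M) => r Br; rewrite -lecR -(uB M)//; exact: AM.
exists (sup B)%:C%C; split => [x Ax|y yA].
  by rewrite (AB _ Ax) lecR; apply: ub_le_sup => //; rewrite /B /= -AB.
rewrite (uB _ yA) lecR; apply: ge_sup => // r Br.
by rewrite -lecR -(uB _ yA); exact: yA.
Qed.

Section bounded_bilinear.
Context {K : numFieldType} {E : normedModType K}.

Definition unit_ball_values (f : E -> E -> E) : set K :=
  [set `|f x y| | x in [set x | `|x| <= 1] & y in [set y | `|y| <= 1]].

Definition bounded_bilinear : {pred E -> E -> E} :=
  mem [set f : E -> E -> E |
       bilinear_for *:%R *:%R f /\ has_ubound (unit_ball_values f)].

Lemma bounded_bilinearP f : f \in bounded_bilinear <->
  bilinear_for *:%R *:%R f /\ has_ubound (unit_ball_values f).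
Proof. by rewrite inE. Qed.

Lemma bounded_bilinear_submod_closed : submod_closed bounded_bilinear.
Proof.
split=> [|a f g /bounded_bilinearP[[fl fr] [M fM]]
          /bounded_bilinearP[[gl gr] [N gN]]]; apply/bounded_bilinearP.
  split; first by split=> u b x y /=; rewrite scaler0 addr0.
  by exists 0 => _ [x _ [y _ <-]]; rewrite normr0.
split.
  split=> u b x y; rewrite /= !fctE.
    rewrite fl gl !scalerDr !scalerA mulrC !addrA; congr (_ + _).
    by rewrite -!addrA; congr (_ + _); rewrite addrC.
  rewrite fr gr !scalerDr !scalerA mulrC !addrA; congr (_ + _).
  by rewrite -!addrA; congr (_ + _); rewrite addrC.
exists (`|a| * M + N) => _ [x x1 [y y1 <-]]; rewrite !fctE.
rewrite (le_trans (ler_normD _ _))// normrZ lerD//.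
  by rewrite ler_wpM2l//; apply: fM; exists x => //; exists y.
by apply: gN; exists x => //; exists y.
Qed.

HB.instance Definition _ :=
  GRing.isSubmodClosed.Build K (E -> E -> E) bounded_bilinear
    bounded_bilinear_submod_closed.

End bounded_bilinear.

(* The space B_2(E); its vector space structure is the pointwise one. *)
Record B2 (K : numFieldType) (E : normedModType K) := MkB2 {
  B2_fun :> E -> E -> E;
  B2_subproof : B2_fun \in bounded_bilinear }.

Section B2_lmodule.
Context {K : numFieldType} {E : normedModType K}.

HB.instance Definition _ := [isSub for @B2_fun K E].
HB.instance Definition _ := [Choice of B2 E by <:].
HB.instance Definition _ := [SubChoice_isSubLmodule of B2 E by <:].

Lemma B2E (f g : B2 E) : (forall x y, f x y = g x y) -> f = g.
Proof. by move=> fg; apply: val_inj; apply/funext => x; apply/funext => y; exact: fg. Qed.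

Lemma B2_addE (f g : B2 E) x y : (f + g) x y = f x y + g x y.
Proof. by []. Qed.

Lemma B2_scaleE (a : K) (f : B2 E) x y : (a *: f) x y = a *: f x y.
Proof. by []. Qed.

Lemma B2_zeroE x y : (0 : B2 E) x y = 0.
Proof. by []. Qed.

Lemma B2_bilinear (f : B2 E) : bilinear_for *:%R *:%R f.
Proof. by have [] := (bounded_bilinearP f).1 (valP f). Qed.

Lemma B2_bounded (f : B2 E) : has_ubound (unit_ball_values f).
Proof. by have [] := (bounded_bilinearP f).1 (valP f). Qed.

Definition opnorm (f : B2 E) : K := supremum 0 (unit_ball_values f).

End B2_lmodule.

Section B2_normed.
Context {R : realType} {k : scalar_kind} {E : normedModType (scalars R k)}.
Implicit Types f g : B2 E.

Lemma unit_ball_values_neq0 f : unit_ball_values f !=set0.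
Proof.
by exists `|f 0 0|; exists 0; rewrite /= ?normr0//; exists 0; rewrite /= ?normr0.
Qed.

Lemma opnorm_isLub f : isLub (unit_ball_values f) (opnorm f).
Proof.
have [s ss] : supremums (unit_ball_values f) !=set0.
  apply: scalars_supremums; [|exact: unit_ball_values_neq0|exact: B2_bounded].
  by move=> _ [x _ [y _ <-]]; exact: normr_ge0.
have V0 : unit_ball_values f != set0 by apply/set0P/unit_ball_values_neq0.
rewrite /opnorm /supremum (negbTE V0).
by case: xgetP => [_ -> [? ?]|/(_ s)].
Qed.

Lemma ler_opnorm1 f x y : `|x| <= 1 -> `|y| <= 1 -> `|f x y| <= opnorm f.
Proof. by move=> x1 y1; apply: (opnorm_isLub f).1; exists x => //; exists y. Qed.

Lemma opnorm_le f M : (forall x y, `|x| <= 1 -> `|y| <= 1 -> `|f x y| <= M) ->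
  opnorm f <= M.
Proof.
by move=> fM; apply: (opnorm_isLub f).2 => _ [x x1 [y y1 <-]]; exact: fM.
Qed.

Lemma opnorm_ge0 f : 0 <= opnorm f.
Proof.
by apply: (le_trans (normr_ge0 (f 0 0))); apply: ler_opnorm1; rewrite normr0.
Qed.

Lemma B2_scalel f a x y : f (a *: x) y = a *: f x y.
Proof.
have f0 : f 0 y = 0.
  have := (B2_bilinear f).1 y 1 0 0.
  by rewrite /= !scale1r addr0 -[LHS]addr0 => /addrI.
by have := (B2_bilinear f).1 y a x 0; rewrite /= f0 !addr0.
Qed.

Lemma B2_scaler f a x y : f x (a *: y) = a *: f x y.
Proof.
have f0 : f x 0 = 0.
  have := (B2_bilinear f).2 x 1 0 0.
  by rewrite /= !scale1r addr0 -[LHS]addr0 => /addrI.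
by have := (B2_bilinear f).2 x a y 0; rewrite /= f0 !addr0.
Qed.

Lemma ler_opnorm f x y : `|f x y| <= opnorm f * `|x| * `|y|.
Proof.
have [->|x0] := eqVneq x 0.
  by rewrite -[X in f X _](scale0r 0) B2_scalel scale0r !normr0 mulr0 mul0r.
have [->|y0] := eqVneq y 0.
  by rewrite -[X in f _ X](scale0r 0) B2_scaler scale0r !normr0 mulr0.
have unit z : z != 0 :> E -> `| `|z|^-1 *: z| <= 1.
  by move=> z0; rewrite normrZ normfV normr_id mulVf ?normr_eq0.
have := ler_opnorm1 f (unit _ x0) (unit _ y0).
rewrite B2_scalel B2_scaler scalerA normrZ normrM !normfV !normr_id.
by rewrite -invfM mulrC ler_pdivrMr ?mulrA// mulr_gt0// normr_gt0.
Qed.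

Lemma opnormD f g : opnorm (f + g) <= opnorm f + opnorm g.
Proof.
apply: opnorm_le => x y x1 y1; rewrite B2_addE (le_trans (ler_normD _ _))//.
by rewrite lerD// ler_opnorm1.
Qed.

Lemma opnormZ_le a f : opnorm (a *: f) <= `|a| * opnorm f.
Proof.
apply: opnorm_le => x y x1 y1.
by rewrite B2_scaleE normrZ ler_wpM2l// ler_opnorm1.
Qed.

Lemma opnormZ a f : opnorm (a *: f) = `|a| * opnorm f.
Proof.
have [->|a0] := eqVneq a 0.
  rewrite scale0r normr0 mul0r; apply/le_anti; rewrite opnorm_ge0 andbT.
  by apply: opnorm_le => x y _ _; rewrite B2_zeroE normr0.
apply/le_anti; rewrite opnormZ_le /=.
have := opnormZ_le a^-1 (a *: f).
by rewrite scalerA mulVf// scale1r normfV mulrC ler_pdivlMr ?normr_gt0// mulrC.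
Qed.

Lemma opnorm0_eq0 f : opnorm f = 0 -> f = 0.
Proof.
move=> f0; apply: B2E => x y; rewrite B2_zeroE; apply/eqP.
by rewrite -normr_le0 (le_trans (ler_opnorm _ _ _))// f0 !mul0r.
Qed.

HB.instance Definition _ := Lmodule_isNormed.Build (scalars R k) (B2 E)
  opnormD opnormZ opnorm0_eq0.

Lemma B2_normE f : `|f| = opnorm f.
Proof. by []. Qed.

End B2_normed.

Section Mltp.
Context {R : realType} {k : scalar_kind} (E : normedModType (scalars R k)).

Definition Mltp : set (B2 E) := [set m | associative m].

Definition unital (m : B2 E) := exists e : E, left_id e m /\ right_id e m.

Definition Mltp_u : set (B2 E) := Mltp `&` [set m | unital m].

Definition Mltp_c : set (B2 E) := Mltp `&` [set m | commutative m].

End Mltp.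

Arguments Mltp {R k} E _.
Arguments Mltp_u {R k} E _.
Arguments Mltp_c {R k} E _.

(* Main.v *)
Require Import Defs.
From mathcomp Require Import all_boot all_order all_algebra.
From mathcomp Require Import all_classical all_reals.
From mathcomp Require Import topology normedtype.
From mathcomp Require Import complex sequences.

Set Implicit Arguments.
Unset Strict Implicit.
Unset Printing Implicit Defensive.

Import Order.TTheory GRing.Theory Num.Theory.
Import numFieldNormedType.Exports.

Local Open Scope classical_set_scope.
Local Open Scope ring_scope.

(** Openness. Let [e] be the unit of a multiplication [m], and let [n] be an
    associative multiplication with [`|m - n| * `|e| < 1]. Multiplications by
    [e] on the left and on the right are the identity for [m], so for [n] they
    differ from the identity by operators of norm less than 1, and by
    completeness both are surjective (Neumann series,
    [near_identity_surjective]). Pure algebra then produces a unit for [n]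
    ([unital_of_surjective]): if [n e u = e], writing an arbitrary element as
    [n y e] gives [n (n y e) u = n y (n e u) = n y e], so [u] is a right unit;
    a left unit arises symmetrically, and the two coincide. The unit of [n] is
    in general different from [e].

    Closedness. Evaluation at a fixed pair of vectors is continuous for the
    operator norm, so commutativity, being a family of equations between
    evaluations, defines a closed set even in the space of all bounded bilinear
    maps. *)

(** The complex case is the real one: a complex number comparable with 0 is
    real, so both [q] and [e] come from real numbers. *)
Lemma scalars_expr_lt (R : realType) (k : scalar_kind) (q e : scalars R k) :
  0 <= q < 1 -> 0 < e -> exists n, q ^+ n < e.
Proof.
have realP (r d : R) : 0 <= r < 1 -> 0 < d -> exists n, r ^+ n < d.
  move=> /andP[r0 r1] d0; have r1' : `|r| < 1 by rewrite ger0_norm.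
  have /cvgrPdist_lt /(_ d d0) [n _ /(_ n (leqnn n))] := cvg_expr r1'.
  by rewrite sub0r normrN ger0_norm ?exprn_ge0//; exists n.
case: k q e => /= q e; first exact: realP.
move=> /andP[q0 q1] e0.
have qE : q = (complex.Re q)%:C%C by rewrite RRe_real// ger0_real.
have eE : e = (complex.Re e)%:C%C by rewrite RRe_real// gtr0_real.
move: q0 q1 e0; rewrite qE eE !(ltcR, lecR) => q0 q1 e0.
have [|n rn] := realP (complex.Re q) (complex.Re e) _ e0; first by rewrite q0.
by exists n; rewrite -rmorphXn ltcR.
Qed.

Section near_identity.
Context {R : realType} {k : scalar_kind}.
Context {E : completeNormedModType (scalars R k)}.
Variables (T : E -> E) (q : scalars R k).
Hypotheses (TB : {morph T : x y / x - y}) (q01 : 0 <= q < 1).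
Hypothesis Tid : forall x, `|T x - x| <= q * `|x|.

Let T0 : T 0 = 0. Proof. by have := TB 0 0; rewrite !subrr. Qed.

Let TD : {morph T : x y / x + y}.
Proof.
by move=> x y; rewrite -{1}[y]opprK -{1}[- y]add0r !TB T0 sub0r opprK.
Qed.

Let q0 : 0 <= q. Proof. by case/andP: q01. Qed.
Let q1 : q < 1. Proof. by case/andP: q01. Qed.

(** The partial sums of the Neumann series of [y], in the form of successive
    corrections by the residual [y - T x]. *)
Let approx (y : E) n := iter n (fun x => x + (y - T x)) 0.

(** Correcting [x] by its residual [r] leaves the residual [r - T r], which is
    at most [q] times as large as [r]. *)
Let residual_le y n : `|y - T (approx y n)| <= q ^+ n * `|y|.
Proof.
elim: n => [|n ih].
  by rewrite /approx /= T0 subr0 mul1r.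
rewrite /approx iterS -/(approx y n) TD opprD addrA.
by rewrite distrC (le_trans (Tid _))// exprS -mulrA ler_wpM2l.
Qed.

(** Geometric summation of the bounds on the residuals, multiplied by [1 - q]
    so that the induction step is an identity between polynomials in [q]. *)
Let approx_dist y n m :
  (1 - q) * `|approx y (n + m) - approx y n| <= q ^+ n * (1 - q ^+ m) * `|y|.
Proof.
elim: m => [|m ih]; first by rewrite addn0 !subrr normr0 !mulr0 mul0r.
rewrite addnS {1}/approx iterS -/(approx y (n + m)) addrAC.
have q1' : 0 <= 1 - q by rewrite subr_ge0 ltW.
have -> : q ^+ n * (1 - q ^+ m.+1) * `|y| =
    q ^+ n * (1 - q ^+ m) * `|y| + (1 - q) * (q ^+ (n + m) * `|y|).
  rewrite !mulrA -mulrDl exprD exprS; congr (_ * _).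
  rewrite mulrBl mul1r !mulrBr !mulr1 addrA subrK.
  by congr (_ - _); rewrite mulrCA.
rewrite (le_trans (ler_wpM2l q1' (ler_normD _ _)))// mulrDr lerD//.
by rewrite ler_wpM2l// residual_le.
Qed.

Let approx_cvg y : cvgn (approx y).
Proof.
apply/cauchy_cvgP/cauchy_exP => e e0.
have d0 : 0 < e * (1 - q) / (`|y| + 1).
  by rewrite divr_gt0// ?mulr_gt0 ?subr_gt0// ltr_wpDl.
have [n qn] := scalars_expr_lt q01 d0.
exists (approx y n); exists n => // m /= nm; rewrite -ball_normE /= distrC.
have q1' : 0 < 1 - q by rewrite subr_gt0.
rewrite -(ltr_pM2l q1') -(subnKC nm) (le_lt_trans (approx_dist _ _ _))//.
move: qn; rewrite ltr_pdivlMr ?ltr_wpDl// [e * _]mulrC.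
apply: le_lt_trans; rewrite -mulrA ler_wpM2l ?exprn_ge0//.
rewrite (@le_trans _ _ (1 * `|y|))//; last by rewrite mul1r lerDl.
by rewrite ler_wpM2r// lerBlDr lerDl exprn_ge0.
Qed.

Let continuous_T : continuous T.
Proof.
have q1' : 0 < 1 + q by rewrite ltr_wpDr.
move=> x; apply/(@cvgrPdist_lt _ _ _ (nbhs x)) => e e0; near=> z.
rewrite -TB (@le_lt_trans _ _ ((1 + q) * `|x - z|))//.
  rewrite -[T _](subrK (x - z)) (le_trans (ler_normD _ _))//.
  by rewrite mulrDl mul1r addrC lerD2l.
rewrite mulrC -ltr_pdivlMr//; near: z.
by apply: cvgr_dist_lt; [exact: cvg_id|rewrite divr_gt0].
Unshelve. all: by end_near. Qed.

(** The limit [x] of the approximations solves [T x = y], because consecutive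
    approximations differ by the residual, which therefore tends to 0. *)
Lemma near_identity_surjective y : exists x, T x = y.
Proof.
exists (limn (approx y)).
have cx := approx_cvg (y := y).
have cTx : T (approx y n) @[n --> \oo] --> T (limn (approx y)).
  by apply: continuous_cvg cx; exact: continuous_T.
have cS : approx y n.+1 - approx y n @[n --> \oo] --> (0 : E).
  rewrite -(subrr (limn (approx y))); apply: cvgB => //.
  by rewrite (cvg_shiftS (approx y)).
(* The sequence below is constant, equal to [y]. *)
have : approx y n.+1 - approx y n + T (approx y n) @[n --> \oo]
    --> 0 + T (limn (approx y)) by apply: cvgD.
under eq_cvg do rewrite {1}/approx iterS [_ + (y - _)]addrC addrK subrK.
rewrite add0r => /cvg_lim <-//; exact: lim_cst.
Qed.

End near_identity.

Section multiplications.
Context {R : realType} {k : scalar_kind}.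

Lemma B2_subl (E : normedModType (scalars R k)) (f : B2 E) z :
  {morph f^~ z : x y / x - y}.
Proof.
move=> x y; have := (B2_bilinear f).1 z (-1) y x.
by rewrite /= !scaleN1r ![- _ + _]addrC.
Qed.

Lemma B2_subr (E : normedModType (scalars R k)) (f : B2 E) z :
  {morph f z : x y / x - y}.
Proof.
move=> x y; have := (B2_bilinear f).2 z (-1) y x.
by rewrite /= !scaleN1r ![- _ + _]addrC.
Qed.

Lemma B2_sub_le (E : normedModType (scalars R k)) (f g : B2 E) x y :
  `|f x y - g x y| <= `|f - g| * `|x| * `|y|.
Proof. exact: (ler_opnorm (f - g)). Qed.

Lemma B2_eval_continuous (E : normedModType (scalars R k)) x y :
  continuous (fun f : B2 E => f x y).
Proof.
have xy0 : 0 < `|x| * `|y| + 1 by rewrite ltr_wpDl// mulr_ge0.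
move=> f; apply/(@cvgrPdist_lt _ _ _ (nbhs f)) => e e0; near=> g.
rewrite (le_lt_trans (B2_sub_le _ _ _ _))//.
rewrite -mulrA (@le_lt_trans _ _ (`|f - g| * (`|x| * `|y| + 1)))//.
  by rewrite ler_wpM2l// lerDl.
rewrite -ltr_pdivlMr//; near: g.
by apply: cvgr_dist_lt; [exact: cvg_id|rewrite divr_gt0].
Unshelve. all: by end_near. Qed.

Lemma closed_commutative (E : normedModType (scalars R k)) :
  closed [set m : B2 E | commutative m].
Proof.
rewrite (_ : mkset _ = \bigcap_(p : E * E)
    ((fun m : B2 E => m p.1 p.2 - m p.2 p.1) @^-1` [set 0])).
  apply: closed_bigI => p _; apply: preimage_closed => [m _|].
    apply: (@cvgB _ _ _ (nbhs (m : B2 E)) _ (fun n : B2 E => n p.1 p.2)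
      (fun n : B2 E => n p.2 p.1)); exact: B2_eval_continuous.
  exact/accessible_closed_set1/hausdorff_accessible/norm_hausdorff.
apply/seteqP; split => m /= mC.
  by move=> p _ /=; rewrite mC subrr.
by move=> x y; have /= /eqP := mC (x, y) I; rewrite subr_eq0 => /eqP.
Qed.

(** A solution [u] of [m e u = e] fixes every product [m y e] by associativity,
    and every vector is such a product. *)
Lemma unital_of_surjective (E : normedModType (scalars R k)) (m : B2 E) e :
  associative m -> (forall y, exists x, m e x = y) ->
  (forall y, exists x, m x e = y) -> unital m.
Proof.
move=> mA lS rS; have [u eu] := lS e; have [v ve] := rS e.
have ur : right_id u m by move=> x; have [y <-] := rS x; rewrite -mA eu.
have vl : left_id v m by move=> x; have [y <-] := lS x; rewrite mA ve.
by exists u; split=> //; have -> : u = v by rewrite -[u]vl ur.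
Qed.

(** Since [m e x = x], the vector [n e x - x] equals [(n - m) e x], of norm at
    most [`|m - n| * `|e| * `|x|]; likewise on the right. *)
Lemma near_unital (E : completeNormedModType (scalars R k)) (m : B2 E) :
  unital m -> \forall n \near m, Mltp E n -> unital n.
Proof.
move=> [e [el er]]; have e1 : 0 < `|e| + 1 by rewrite ltr_wpDl.
near=> n => nA.
(* [`|e| + 1] replaces [`|e|] to have a nonzero divisor. *)
have q01 : 0 <= `|m - n| * `|e| < 1.
  rewrite mulr_ge0//= (@le_lt_trans _ _ (`|m - n| * (`|e| + 1)))//.
    by rewrite ler_wpM2l// lerDl.
  rewrite -ltr_pdivlMr//; near: n.
  by apply: cvgr_dist_lt; [exact: cvg_id|rewrite divr_gt0].
apply: (unital_of_surjective (e := e)) => // y.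
  apply: near_identity_surjective q01 _ _ => [|x]; first exact: B2_subr.
  by rewrite -{2}[x]el distrC B2_sub_le.
apply: near_identity_surjective q01 _ _ => [|x]; first exact: B2_subl.
by rewrite -{2}[x]er distrC (le_trans (B2_sub_le _ _ _ _))// mulrAC.
Unshelve. all: by end_near. Qed.

End multiplications.

Theorem theorem3p3 (R : realType) (k : scalar_kind)
    (E : completeNormedModType (scalars R k)) (E_neq0 : exists x : E, x != 0) :
  open (Mltp_u E : set (subspace (Mltp E))) /\
  closed (Mltp_c E : set (subspace (Mltp E))).
Proof.
split.
  apply/open_subspaceP.
  (* In the whole space, [Mltp_u E] need not be open; the open set whose trace
     on [Mltp E] is [Mltp_u E] is found as an interior. *)
  exists (interior [set n : B2 E | associative n -> unital n]).
    exact: open_interior.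
  apply/seteqP; split => m /= [mU mA].
    by split=> //; split=> //; exact: (interior_subset mU).
  by split=> //; apply: near_unital; case: mU.
apply/closed_subspaceP; exists [set m : B2 E | commutative m].
  exact: closed_commutative.
by rewrite /Mltp_c setIAC setIid setIC.
Qed.
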